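(* For every integer $r\ge3$, \[ \mathscr{P}_{C_r} (q) = (1+q)^2\bigl( \mathscr{P}_{C_{r-1}} (q)-q\bigr) - q^3 \left( \sum_{i=1}^{r-2} \mathscr{P}_{C_i}(q) \right )+(q+q^2+q^3), \] where $\mathscr{P}_{C_i}(q)$ denotes the $q$-analog of Kostant's partition function at the highest root of type $C_i$.
   Context: Type $C_r$, $r\ge1$: with simple roots $\alpha_1,\dots,\alpha_r$ ($\alpha_r$ long), the positive roots are $\alpha_i+\cdots+\alpha_j$ for $1\le i\le j\le r$; $\alpha_i+\cdots+\alpha_{j-1}+2\alpha_j+\cdots+2\alpha_{r-1}+\alpha_r$ for $1\le i<j\le r-1$; and $2\alpha_i+\cdots+2\alpha_{r-1}+\alpha_r$ for $1\le i\le r-1$. The highest root is $\tilde\alpha=2\alpha_1+\cdots+2\alpha_{r-1}+\alpha_r$ (for $r=1$, $\tilde\alpha=\alpha_1$). A partition of $\tilde\alpha$ with $k$ parts is a multiset of $k$ positive roots (repetitions allowed) summing to $\tilde\alpha$, and $\mathscr{P}_{C_r}(q)=\sum_{k\ge1}a_kq^k$ where $a_k$ is the number of partitions of $\tilde\alpha$ with exactly $k$ parts. *)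

(* Defs.v *)
From HB Require Import structures.
From mathcomp Require Import all_boot all_order all_algebra.
Set Implicit Arguments. Unset Strict Implicit. Unset Printing Implicit Defensive.
Import Order.TTheory GRing.Theory Num.Theory.
Local Open Scope ring_scope.

(** The root lattice of type C_r is Z^r, in coordinates with respect to the
    simple roots.  Simple roots are indexed from 1: [simple_root r i] is
    alpha_i for 1 <= i <= r, and 0 for other values of i. *)
Definition simple_root (r i : nat) : 'rV[int]_r :=
  \row_(k < r) (k.+1 == i)%:R.

Definition pos_roots (r : nat) : seq 'rV[int]_r :=
  [seq \sum_(i <= k < j.+1) simple_root r k
     | i <- index_iota 1 r.+1, j <- index_iota i r.+1]
  ++ [seq \sum_(i <= k < j) simple_root r k
          + \sum_(j <= k < r) simple_root r k *+ 2 + simple_root r r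
        | i <- index_iota 1 r, j <- index_iota i.+1 r]
  ++ [seq \sum_(i <= k < r) simple_root r k *+ 2 + simple_root r r
        | i <- index_iota 1 r].

Definition highest_root (r : nat) : 'rV[int]_r :=
  \sum_(1 <= k < r) simple_root r k *+ 2 + simple_root r r.

(** A multiset of k positive roots is encoded by its multiplicity function,
    whose values are necessarily at most k. *)
Definition partitions (r k : nat) :
    {set {ffun seq_sub (pos_roots r) -> 'I_k.+1}} :=
  [set m : {ffun seq_sub (pos_roots r) -> 'I_k.+1} |
     (\sum_b (m b : nat) == k)%N &&
     (\sum_b val b *+ m b == highest_root r)].

(** The sum over k >= 1 of a_k q^k, with a_k = #|partitions r k|.  It stops at
    k = 2r - 1, the height of the highest root; [coef_kostantC] shows that no
    term is lost. *)
Definition kostantC (r : nat) : {poly int} :=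
  \sum_(1 <= k < r.*2) #|partitions r k|%:R *: 'X^k.

Definition height (r : nat) (v : 'rV[int]_r) : int := \sum_i v 0 i.

Lemma heightD r (u v : 'rV[int]_r) : height (u + v) = height u + height v.
Proof. by rewrite /height -big_split; apply: eq_bigr => i _; rewrite mxE. Qed.

Lemma height0 r : height (0 : 'rV[int]_r) = 0.
Proof. by rewrite /height big1 // => i _; rewrite mxE. Qed.

Lemma heightMn r (v : 'rV[int]_r) n : height (v *+ n) = height v *+ n.
Proof. by elim: n => [|n IH]; rewrite ?mulr0n ?height0 // !mulrS heightD IH. Qed.

Lemma height_sum r (I : Type) (s : seq I) (P : pred I) (F : I -> 'rV[int]_r) :
  height (\sum_(i <- s | P i) F i) = \sum_(i <- s | P i) height (F i).
Proof. exact: (big_morph _ (@heightD r) (height0 r)). Qed.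

Lemma height_simple r i : (0 < i <= r)%N -> height (simple_root r i) = 1.
Proof.
case: i => // i /= ir; rewrite /height (bigD1 (Ordinal ir)) //= mxE eqxx big1 ?addr0 // => j.
by rewrite mxE eqSS -val_eqE /= => /negbTE ->.
Qed.

Lemma height_simple_ge0 r i : 0 <= height (simple_root r i).
Proof. by apply: sumr_ge0 => j _; rewrite mxE ler0n. Qed.

Lemma height_pos_root r b : b \in pos_roots r -> 1 <= height b.
Proof.
have S (I : Type) (s : seq I) (f : I -> nat) n :
    0 <= height (\sum_(k <- s) simple_root r (f k) *+ n).
  by rewrite height_sum sumr_ge0 // => k _; rewrite heightMn mulrn_wge0 // height_simple_ge0.
have S1 m n : 0 <= height (\sum_(m <= k < n) simple_root r k).
  by rewrite height_sum sumr_ge0 // => k _; rewrite height_simple_ge0.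
rewrite !mem_cat => /or3P[] /=.
- case/allpairsPdep => i [j [+ + ->]]; rewrite !mem_index_iota => /andP[i0 ir] /andP[ij jr].
  rewrite big_ltn ?ltnS // heightD height_simple ?i0 //= lerDl; exact: S1.
- case/allpairsPdep => i [j [+ + ->]]; rewrite !mem_index_iota => /andP[i0 ir] _.
  rewrite heightD (@height_simple r r) ?leqnn ?andbT ?(leq_trans i0 (ltnW ir)) // lerDr heightD.
  by apply: addr_ge0; [apply: S1 | apply: (S _ _ id)].
- case/mapP => i; rewrite mem_index_iota => /andP[i0 ir] ->.
  rewrite heightD (@height_simple r r) ?leqnn ?andbT ?(leq_trans i0 (ltnW ir)) // lerDr.
  exact: (S _ _ id).
Qed.

Lemma height_highest_root r : (0 < r)%N -> height (highest_root r) = (r.*2.-1)%:R.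
Proof.
case: r => // r _; rewrite /highest_root heightD height_simple ?leqnn // height_sum.
rewrite (eq_big_nat _ _ (F2 := fun=> 2)); last first.
  by move=> k /andP[k0 kr]; rewrite heightMn height_simple ?k0 ?(ltnW kr).
by rewrite big_const_nat iter_addr_0 subSS subn0 -mulrnA mul2n doubleS /= -natr1.
Qed.

Lemma card_partitions_eq0 r k :
  (0 < r)%N -> (k == 0)%N || (r.*2 <= k)%N -> #|partitions r k| = 0%N.
Proof.
move=> r0 hk; apply: eq_card0 => m; rewrite inE; apply/negP => /andP[/eqP mk /eqP mh].
have := height_highest_root r0; rewrite -mh height_sum.
case/orP: hk => [/eqP k0 | kr].
  rewrite big1 => [/esym/eqP|b _].
    by rewrite pnatr_eq0; case: (r) r0.
  by rewrite heightMn; case: (m b) => -[|x] /=; rewrite ?k0.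
move/eqP; rewrite gt_eqF //.
apply: (@lt_le_trans _ _ (k%:R)).
  by rewrite ltr_nat prednK ?double_gt0.
rewrite -[k in k%:R]mk natr_sum ler_sum // => b _.
by rewrite heightMn lerMn2r (height_pos_root (valP b)) orbT.
Qed.

Lemma coef_kostantC r k : (0 < r)%N -> (kostantC r)`_k = #|partitions r k|%:R.
Proof.
move=> r0; rewrite /kostantC coef_sum.
case: (boolP (0 < k < r.*2)%N) => [hk|].
  rewrite (bigD1_seq k) ?mem_index_iota ?iota_uniq //= coefZ coefXn eqxx mulr1.
  by rewrite big1 ?addr0 // => i /negbTE; rewrite eq_sym coefZ coefXn => ->; rewrite mulr0.
move=> nk; rewrite card_partitions_eq0 //; last by rewrite negb_and -leqNgt leqn0 -leqNgt in nk.
rewrite big_nat big1 // => i hi; rewrite coefZ coefXn; case: eqP => [e|]; last by rewrite mulr0.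
by rewrite e hi in nk.
Qed.

(* Main.v *)
(** In the basis e_1, ..., e_r with alpha_i = e_i - e_(i+1) for i < r and
    alpha_r = 2 e_r, the highest root is 2 e_1 and the positive roots are
    e_i - e_j for i < j and e_i + e_j for i <= j.  A partition of 2 e_1 has
    exactly one part e_i + e_j, and its other parts form a partition of
    2 e_1 - e_i - e_j into roots e_a - e_b, where b <= max i j.  If F i j is the
    generating function of the latter, which does not depend on r, then P_r is
    q times the sum of the F i j over i <= j <= r.  Removing the parts e_a - e_r
    gives F i r = q * sum_(j < r) F i j for i < r, and
    F r r = q^2 * sum_(i <= j < r) F i j = q P_(r-1) for r > 1.  Summing F i r
    over i < r gives 2 P_(r-1) - q * sum_(i < r) F i i, and the recurrence is
    the resulting formula for P_r - P_(r-1). *)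

Require Import Defs.
From HB Require Import structures.
From mathcomp Require Import all_boot all_order all_algebra.
From mathcomp Require Import ring.
Import Order.TTheory GRing.Theory Num.Theory.
Local Open Scope ring_scope.

(* Number of multisets of [k] elements of [s] with sum [v]; equal entries of [s]
   at different positions count as different parts. *)
Fixpoint npart (V : zmodType) (s : seq V) (v : V) (k : nat) : nat :=
  if s is b :: s' then
    (\sum_(j < k.+1) npart V s' (v - b *+ j) (k - j))%N
  else (v == 0) && (k == 0%N).
Arguments npart {V}.

(** * Counting multisets of a list by their number of parts and their sum *)

Section Npart.
Context {V : zmodType}.
Implicit Types (s : seq V) (v b : V).

Lemma npart_cons0 b s v : npart (b :: s) v 0 = npart s v 0.
Proof. by rewrite /= big_ord_recl big_ord0 addn0 mulr0n subr0. Qed.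

(** Pascal-type recurrence: either [b] is not a part, or one copy of it is removed. *)
Lemma npart_consS b s v k :
  npart (b :: s) v k.+1 = (npart s v k.+1 + npart (b :: s) (v - b) k)%N.
Proof.
rewrite /= big_ord_recl mulr0n subr0 subn0; congr addn.
by apply: eq_bigr => i _; rewrite /= mulrS opprD addrA subSS.
Qed.

Lemma npart0 s v : npart s v 0 = (v == 0).
Proof. by elim: s => [|b s IH]; rewrite ?npart_cons0 //= andbT. Qed.

(** Strong induction on the number of parts: once [npart_consS] has expanded both sides, the terms
    where a part has been removed count fewer parts, so their lists may be reordered. *)
Lemma npart_swap a b s v k : npart (a :: b :: s) v k = npart (b :: a :: s) v k.
Proof.
elim/ltn_ind: k v => -[|k] IH v; first by rewrite !npart_cons0.
rewrite 2!npart_consS (npart_consS b) (npart_consS a s) -!addnA; congr addn.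
case: k IH => [|k] IH; first by rewrite !npart_cons0 addnC.
rewrite IH // -[npart _ (v - b) k.+1 in RHS]IH //.
by rewrite (npart_consS b (a :: s)) (npart_consS a (b :: s)) IH // addrAC addnCA.
Qed.

Lemma npart_perm s1 s2 v k : perm_eq s1 s2 -> npart s1 v k = npart s2 v k.
Proof.
have head b s t : npart (b :: s ++ t) =2 npart (s ++ b :: t).
  elim: s => //= c s IH w l; rewrite -[LHS]/(npart [:: b, c & s ++ t] w l).
  by rewrite npart_swap /=; apply: eq_bigr => j _; rewrite IH.
elim: s1 s2 v k => [|b s1 IH] s2 v k; first by rewrite perm_sym => /perm_nilP ->.
move=> p; have := perm_mem p b; rewrite mem_head => /esym bs2.
case/splitPr: bs2 p => t1 t2; rewrite perm_sym -(cat1s b t2) perm_catCA /= perm_cons perm_sym => p.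
by rewrite -head /=; apply: eq_bigr => j _; rewrite (IH _ _ _ p).
Qed.

End Npart.

Lemma card_npart (V : zmodType) (I : finType) (f : I -> V) (v : V) (n k : nat) : (k <= n)%N ->
  #|[set m : {ffun I -> 'I_n.+1} |
      (\sum_b (m b : nat) == k)%N && (\sum_b f b *+ m b == v)]|
  = npart [seq f b | b <- enum I] v k.
Proof.
(* Multiplicity functions supported in [s] allow induction on [s]; the codomain bound [n] stays
   fixed while the number of parts [l] decreases. *)
have sup s : uniq s -> forall w l, (l <= n)%N ->
    #|[set m : {ffun I -> 'I_n.+1} | [&& [forall b, (b \notin s) ==> (m b == ord0)],
      (\sum_(b <- s) (m b : nat) == l)%N & \sum_(b <- s) f b *+ m b == w]]|
    = npart [seq f b | b <- s] w l.
  elim: s => [_ w l _|b s IH /= /andP[bs us] w l ln].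
    case: (boolP ((w == 0) && (l == 0%N))) => /= h.
      rewrite h -[RHS]/1%N -(cards1 ([ffun=> ord0] : {ffun I -> 'I_n.+1})).
      case/andP: h => /eqP -> /eqP ->; congr #|pred_of_set _|; apply/setP => m.
      rewrite !inE !big_nil !eqxx !andbT; apply/forallP/eqP => [h|-> c]; last by rewrite ffunE.
      by apply/ffunP => c; rewrite ffunE; apply/eqP/h.
    rewrite (negbTE h); apply: eq_card0 => m; rewrite !inE !big_nil; apply/negP.
    case/and3P => _ /eqP e1 /eqP e2.
    by rewrite -e1 -e2 !eqxx in h.
  (* Sort by the multiplicity of [b], which is at most [l]. *)
  rewrite -sum1_card (partition_big (fun m : {ffun I -> 'I_n.+1} => inord (m b) : 'I_l.+1) predT) //=.
  apply: eq_bigr => j _.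
  have jl : (j <= l)%N by rewrite -ltnS.
  have jn : (j < n.+1)%N by rewrite ltnS (leq_trans jl).
  rewrite -IH ?(leq_trans (leq_subr _ _)) // -sum1_card.
  (* Overwriting the value at [b] by [j], or back by 0, is the bijection between functions supported
     in [s] and those on [b :: s] with multiplicity [j] at [b]. *)
  pose h c (m : {ffun I -> 'I_n.+1}) := [ffun x => if x == b then c else m x].
  have sumh (W : nmodType) (g : I -> 'I_n.+1 -> W) c m :
      \sum_(x <- s) g x (h c m x) = \sum_(x <- s) g x (m x).
    apply: eq_big_seq => x xs; rewrite ffunE; case: eqP => // e.
    by rewrite -e xs in bs.
  rewrite (reindex_onto (h (inord j)) (h ord0)); last first.
    move=> m; rewrite !inE big_cons => /andP[/and3P[_ /eqP ml _] /eqP mj].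
    apply/ffunP => x; rewrite !ffunE; case: eqP => // ->; apply: val_inj.
    have mbl : (m b < l.+1)%N by rewrite ltnS -ml leq_addr.
    by rewrite /= -mj (inordK mbl) inordK // ltn_ord.
  apply: eq_bigl => m; rewrite !inE !big_cons.
  have -> : h (inord j) m b = inord j by rewrite ffunE eqxx.
  rewrite (inordK jn) inord_val eqxx andbT.
  rewrite (sumh V (fun x c => f x *+ c)) (sumh nat (fun x c => nat_of_ord c)).
  rewrite [X in _ = [&& _, _ & X]]eq_sym subr_eq [w == _]eq_sym addrC.
  have -> : (\sum_(x <- s) nat_of_ord (m x) == l - j)%N
          = (j + \sum_(x <- s) nat_of_ord (m x) == l)%N.
    by rewrite -(eqn_add2l j) subnKC.
  rewrite andbC !andbA; congr (_ && _ && _).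
  apply/andP/forallP => [[/eqP e /forallP hm] x|hm].
    apply/implyP => xs; case: (eqVneq x b) => [->|xb].
      by rewrite -e ffunE eqxx.
    by have := hm x; rewrite inE negb_or xb xs ffunE (negbTE xb).
  split.
    apply/eqP/ffunP => x; rewrite !ffunE; case: eqP => // ->.
    by apply/esym/eqP/(implyP (hm b)).
  apply/forallP => x; rewrite inE negb_or; apply/implyP => /andP[xb xs].
  by rewrite ffunE (negbTE xb) (implyP (hm x)).
move=> kn; rewrite -sup ?enum_uniq //; apply: eq_card => m.
rewrite !inE !big_enum /=; case: forallP => //= -[] x; rewrite mem_enum inE.
by [].
Qed.

(** * Removing the parts detected by an additive functional *)

Section Peel.
(* On partitions into parts of [s ++ t], [phi] is [c] times the number of parts
   taken from [s]. *)
Context {V : zmodType} (phi : {additive V -> int}) (c : int) (c0 : c != 0).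
Implicit Types (s t : seq V) (v : V).

Lemma npart_phi_neq0 t v k : {in t, forall b, phi b = 0} -> phi v != 0 ->
  npart t v k = 0%N.
Proof.
elim: t v k => [|b t IH] v k ht hv /=.
  by case: (v =P 0) hv => [->|//]; rewrite raddf0 eqxx.
rewrite big1 // => j _; apply: IH => [x xt|]; first by rewrite ht // inE xt orbT.
by rewrite raddfB raddfMn (ht b) ?mem_head // mul0rn subr0.
Qed.

(** Applying [phi] to a partition shows that exactly [z] parts come from [s], which is impossible if
    [z] is negative or exceeds the number of parts. *)
Lemma npart_peel_lt s t v k (z : int) :
  {in s, forall b, phi b = c} -> {in t, forall b, phi b = 0} ->
  phi v = c * z -> (z < 0) || (k%:Z < z) -> npart (s ++ t) v k = 0%N.
Proof.
move=> + ht; elim: s v k z => [|b s IH] v k z hs hv hz.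
  apply: npart_phi_neq0 => //; rewrite hv mulf_neq0 //.
  by case/orP: hz => [/lt_eqF->//|h]; rewrite gt_eqF // (le_lt_trans _ h).
(* Taking [j] copies of [b] lowers both [z] and [k] by [j], so either obstruction persists. *)
rewrite /= big1 // => j _; apply: (IH _ _ (z - j%:Z)).
- by move=> x xs; apply: hs; rewrite inE xs orbT.
- by rewrite raddfB raddfMn (hs b) ?mem_head // hv mulrBr -[j%:Z]natz mulr_natr.
- have jk : (j <= k)%N by rewrite -ltnS.
  case/orP: hz => h; first by rewrite (le_lt_trans _ h) // gerBl.
  by rewrite -subzn // ltrD2r h orbT.
Qed.

Lemma npart_peel0 s t v k :
  {in s, forall b, phi b = c} -> {in t, forall b, phi b = 0} ->
  phi v = 0 -> npart (s ++ t) v k = npart t v k.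
Proof.
move=> + ht hv; elim: s => // b s IH hs.
have hs' : {in s, forall b, phi b = c} by move=> x xs; apply: hs; rewrite inE xs orbT.
case: k IH => [|k] IH; first by rewrite cat_cons npart_cons0 IH.
rewrite cat_cons npart_consS IH // -cat_cons.
(* Removing a copy of [b] sends [phi] from 0 to [-c], hence [z = -1]. *)
rewrite (npart_peel_lt _ _ _ _ (-1)) ?addn0 //.
by rewrite raddfB hv (hs b) ?mem_head // sub0r mulrN1.
Qed.

Lemma npart_peel1 s t v k :
  {in s, forall b, phi b = c} -> {in t, forall b, phi b = 0} ->
  phi v = c -> npart (s ++ t) v k.+1 = (\sum_(b <- s) npart t (v - b) k)%N.
Proof.
move=> + ht hv; elim: s => [|b s IH] hs.
  by rewrite big_nil npart_phi_neq0 ?hv.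
have hs' : {in s, forall b, phi b = c} by move=> x xs; apply: hs; rewrite inE xs orbT.
rewrite big_cons cat_cons npart_consS IH // -cat_cons npart_peel0 1?addnC //.
by rewrite raddfB hv (hs b) ?mem_head // subrr.
Qed.

(** Exactly two parts come from the list, and [i <= j] makes the pair unordered. The list is
    reversed so that raising [n] adds a new head; a partition using that head has one more listed
    part, given by [npart_peel1]. *)
Lemma npart_peel2 (g : nat -> V) n t v k :
  (forall i, (i < n)%N -> phi (g i) = c) -> {in t, forall b, phi b = 0} ->
  phi v = c *+ 2 ->
  npart ([seq g i | i <- rev (iota 0 n)] ++ t) v k.+2
  = (\sum_(j < n) \sum_(i < j.+1) npart t (v - g i - g j) k)%N.
Proof.
move=> + ht hv; elim: n => [|n IH] hg.
  by rewrite big_ord0 npart_phi_neq0 ?hv // -mulr_natr mulf_neq0.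
have hgs m : (m <= n.+1)%N -> {in [seq g i | i <- rev (iota 0 m)], forall b, phi b = c}.
  move=> mn x /mapP[i]; rewrite mem_rev mem_iota => /= im ->.
  by rewrite hg // (leq_trans im).
have E : rev (iota 0 n.+1) = n :: rev (iota 0 n) by rewrite -addn1 iotaD rev_cat.
rewrite E map_cons cat_cons npart_consS -cat_cons -map_cons -E.
rewrite IH; last by move=> i h; apply: hg; apply: ltnW.
rewrite npart_peel1 //; [|exact: hgs|by rewrite raddfB hv hg // mulr2n addrK].
rewrite big_ord_recr; congr addn.
rewrite big_map (perm_big _ (permEl (perm_rev _))) -[iota 0 n.+1]/(index_iota 0 n.+1) big_mkord.
by apply: eq_bigr => i _; rewrite addrAC.
Qed.

End Peel.

(** * Type C roots as polynomials *)

(* The standard basis vector e_(i+1) is encoded by 'X^i, which gives all ranks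
   the same ambient group. *)
Definition simple_poly (r k : nat) : {poly int} :=
  if (k.+1 < r)%N then 'X^k - 'X^(k.+1) else 'X^k *+ 2.

Definition root_poly (r : nat) (v : 'rV[int]_r) : {poly int} :=
  \sum_k v 0 k *: simple_poly r k.

Lemma root_poly_is_zmod_morphism r : zmod_morphism (@root_poly r).
Proof.
move=> u v; rewrite /root_poly -sumrB; apply: eq_bigr => k _.
by rewrite !mxE scalerBl.
Qed.

HB.instance Definition _ r := GRing.isZmodMorphism.Build _ _ (@root_poly r)
  (@root_poly_is_zmod_morphism r).

Lemma sum_coefXn (m k : nat) :
  \sum_(i < k.+1) ('X^m : {poly int})`_i = (m <= k)%N%:R.
Proof.
case: leqP => mk.
  rewrite (bigD1 (Ordinal (mk : (m < k.+1)%N))) //= coefXn eqxx big1 ?addr0 // => i.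
  by rewrite -val_eqE /= coefXn => /negbTE ->.
by rewrite big1 // => i _; rewrite coefXn ltn_eqF // (leq_ltn_trans _ mk) // -ltnS.
Qed.

(** The sum of the coefficients up to degree [k] isolates coordinate [k]: every other simple root
    contributes 0 to it, and [alpha_(k+1)] contributes 1, or 2 if it is long. *)
Lemma root_poly_inj r : injective (@root_poly r).
Proof.
apply: raddf_inj => v v0; apply/rowP => k; rewrite mxE.
have : \sum_(i < k.+1) (root_poly r v)`_i = 0.
  by rewrite v0 big1 // => i _; rewrite coef0.
under eq_bigr do rewrite coef_sum.
rewrite exchange_big (bigD1 k) //= [X in _ + X]big1 ?addr0.
  under eq_bigr do rewrite coefZ.
  rewrite -mulr_sumr /simple_poly; case: ifP => _.
    under eq_bigr do rewrite coefB.
    by rewrite sumrB !sum_coefXn leqnn ltnn subr0 mulr1.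
  under eq_bigr do rewrite coefMn.
  rewrite sumrMnl sum_coefXn leqnn => /eqP; rewrite mulf_eq0 orbF => /eqP //.
move=> m mk; under eq_bigr do rewrite coefZ.
rewrite -mulr_sumr /simple_poly; case: ifP => mr.
  under eq_bigr do rewrite coefB.
  rewrite sumrB !sum_coefXn [(m <= k)%N]leq_eqVlt val_eqE (negbTE mk) /=.
  by rewrite subrr mulr0.
under eq_bigr do rewrite coefMn.
rewrite sumrMnl sum_coefXn leqNgt ltn_neqAle.
have -> : (k <= m)%N.
  by rewrite -ltnS (leq_trans (ltn_ord k)) // leqNgt mr.
by rewrite andbT val_eqE eq_sym mk /= mul0rn mulr0.
Qed.

Lemma root_poly_simple r i : (i < r)%N ->
  root_poly r (simple_root r i.+1) = simple_poly r i.
Proof.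
move=> ir; rewrite /root_poly (bigD1 (Ordinal ir)) //= mxE eqxx scale1r.
rewrite big1 ?addr0 // => k; rewrite -val_eqE mxE eqSS /= => /negbTE ->.
by rewrite scale0r.
Qed.

Lemma root_poly_last r : root_poly r.+1 (simple_root r.+1 r.+1) = 'X^r *+ 2.
Proof. by rewrite root_poly_simple // /simple_poly ltnn. Qed.

Lemma root_poly_segment r i j : (i <= j)%N -> (j < r)%N ->
  root_poly r (\sum_(i.+1 <= k < j.+1) simple_root r k) = 'X^i - 'X^j.
Proof.
move=> ij jr; rewrite raddf_sum big_add1 /=.
rewrite (eq_big_nat _ _ (F2 := fun k => - 'X^(k.+1) - - 'X^k)); last first.
  move=> k /andP[_ kj]; rewrite root_poly_simple ?(ltn_trans kj) //.
  by rewrite /simple_poly (leq_trans _ jr) ?ltnS // opprK addrC.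
by rewrite telescope_sumr // opprK addrC.
Qed.

Lemma root_poly_segment2 r i j : (i <= j)%N -> (j < r)%N ->
  root_poly r (\sum_(i.+1 <= k < j.+1) simple_root r k *+ 2) = ('X^i - 'X^j) *+ 2.
Proof. by move=> ij jr; rewrite sumrMnl raddfMn /= root_poly_segment. Qed.

(** Positive roots of type A, with those involving the last basis vector in front, in the order that
    [npart_peel2] expects. *)
Fixpoint rootsA (n : nat) : seq {poly int} :=
  if n is m.+1 then [seq 'X^i - 'X^m | i <- rev (iota 0 m)] ++ rootsA m
  else [::].

(** The case [i = j] gives the long roots of type C. *)
Definition rootsD (n : nat) : seq {poly int} :=
  [seq 'X^i + 'X^j | j <- iota 0 n, i <- iota 0 j.+1].

Lemma rootsAP n (p : {poly int}) :
  reflect (exists i j, [/\ (i < j)%N, (j < n)%N & p = 'X^i - 'X^j]) (p \in rootsA n).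
Proof.
elim: n p => [|n IH] p; first by constructor => -[i [j []]].
rewrite mem_cat; apply: (iffP orP) => [[/mapP[i]|/IH[i [j [ij jn ->]]]]|[i [j [ij]]]].
- by rewrite mem_rev mem_iota => /= ij ->; exists i, n.
- by exists i, j; split=> //; apply: ltnW.
- rewrite ltnS leq_eqVlt => /orP[/eqP<- ->|jn ->].
    by left; apply/mapP; exists i; rewrite // mem_rev mem_iota.
  by right; apply/IH; exists i, j.
Qed.

Lemma rootsDP n (p : {poly int}) :
  reflect (exists i j, [/\ (i <= j)%N, (j < n)%N & p = 'X^i + 'X^j]) (p \in rootsD n).
Proof.
apply: (iffP allpairsPdep) => [[j [i []]]|[i [j [ij jn ->]]]].
  by rewrite !mem_iota !add0n !ltnS => /= jn ij ->; exists i, j.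
by exists j, i; rewrite !mem_iota.
Qed.

Lemma polyXn_inj : injective (fun i => 'X^i : {poly int}).
Proof.
by move=> i j /(congr1 (fun p : {poly int} => size p)); rewrite !size_polyXn => -[].
Qed.

Lemma coef_rootsA_last n :
  {in [seq 'X^i - 'X^n | i <- rev (iota 0 n)], forall b : {poly int}, coefp n b = -1}.
Proof.
move=> _ /mapP[i + ->]; rewrite mem_rev mem_iota => /= lt_in.
by rewrite coefB !coefXn eqxx gtn_eqF // sub0r.
Qed.

Lemma coef_rootsA_eq0 n : {in rootsA n, forall b : {poly int}, coefp n b = 0}.
Proof.
move=> _ /rootsAP[i [j [ij jn ->]]].
by rewrite /= coefB !coefXn !gtn_eqF ?subr0 // (ltn_trans ij).
Qed.

Lemma rootsA_uniq n : uniq (rootsA n).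
Proof.
elim: n => //= n IH; rewrite cat_uniq IH andbT map_inj_uniq ?rev_uniq ?iota_uniq.
  apply/hasPn => p /coef_rootsA_eq0 p0; apply/negP => /coef_rootsA_last.
  by rewrite p0.
by move=> i j /addIr/polyXn_inj.
Qed.

Lemma rootsD_uniq n : uniq (rootsD n).
Proof.
apply: allpairs_uniq_dep => [|j _|]; rewrite ?iota_uniq //.
(* The coefficient of degree [j'] vanishes on the left side only. *)
have lt_neq i j i' j' : (i <= j)%N -> (i' <= j')%N -> (j < j')%N ->
    'X^i + 'X^j = 'X^i' + 'X^j' :> {poly int} -> False.
  move=> ij ij' jj /(congr1 (fun p : {poly int} => p`_j')).
  rewrite !coefD !coefXn eqxx !(gtn_eqF jj) (gtn_eqF (leq_ltn_trans ij jj)).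
  by case: (_ == _).
move=> _ _ /allpairsPdep[j [i [_ + ->]]] /allpairsPdep[j' [i' [_ + ->]]] /=.
rewrite !mem_iota !add0n !ltnS => /= ij ij'.
case: (ltngtP j j') => [jj /lt_neq|jj /esym/lt_neq|-> /addIr/polyXn_inj -> //].
  by case.
by case.
Qed.

(** Evaluation at 1 adds the coordinates; it is the functional that counts the parts e_i + e_j. *)
Lemma horner1_rootsD n : {in rootsD n, forall b : {poly int}, horner_eval 1 b = 2}.
Proof.
by move=> _ /rootsDP[i [j [_ _ ->]]]; rewrite /horner_eval hornerD !hornerXn !expr1n.
Qed.

Lemma horner1_rootsA n : {in rootsA n, forall b : {poly int}, horner_eval 1 b = 0}.
Proof.
move=> _ /rootsAP[i [j [_ _ ->]]].
by rewrite /horner_eval hornerD hornerN !hornerXn !expr1n subrr.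
Qed.

Lemma rootsC_uniq n : uniq (rootsD n ++ rootsA n).
Proof.
rewrite cat_uniq rootsD_uniq rootsA_uniq andbT.
apply/hasPn => p /horner1_rootsA p0; apply/negP => /horner1_rootsD.
by rewrite p0.
Qed.

(** * Matching the positive roots with the polynomial lists *)

Lemma pos_rootsP r (v : 'rV[int]_r) :
  reflect
    [\/ exists i j, [/\ (i <= j)%N, (j < r)%N
          & v = \sum_(i.+1 <= k < j.+2) simple_root r k],
        exists i j, [/\ (i < j)%N, (j.+1 < r)%N
          & v = \sum_(i.+1 <= k < j.+1) simple_root r k
                + \sum_(j.+1 <= k < r) simple_root r k *+ 2 + simple_root r r]
      | exists2 i, (i.+1 < r)%N
          & v = \sum_(i.+1 <= k < r) simple_root r k *+ 2 + simple_root r r]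
    (v \in pos_roots r).
Proof.
rewrite !mem_cat; apply: (iffP or3P) => -[].
- case/allpairsPdep => -[|i] [[|j] []]; rewrite !mem_index_iota //= => ir /andP[ij jr] ->.
  by constructor 1; exists i, j.
- case/allpairsPdep => -[|i] [[|j] []]; rewrite !mem_index_iota //= => ir /andP[ij jr] ->.
  by constructor 2; exists i, j.
- case/mapP => -[|i]; rewrite mem_index_iota //= => ir ->.
  by constructor 3; exists i.
- case=> i [j [ij jr ->]]; constructor 1; apply/allpairsPdep; exists i.+1, j.+1.
  by rewrite !mem_index_iota /= !ltnS ij jr (leq_ltn_trans ij).
- case=> i [j [ij jr ->]]; constructor 2; apply/allpairsPdep; exists i.+1, j.+1.
  by rewrite !mem_index_iota /= !ltnS ij jr (leq_ltn_trans ij (ltnW jr)).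
- case=> i ir ->; constructor 3; apply/mapP; exists i.+1 => //.
  by rewrite mem_index_iota.
Qed.

Lemma root_poly_segment_last r i : (i <= r)%N ->
  root_poly r.+1 (\sum_(i.+1 <= k < r.+2) simple_root r.+1 k) = 'X^i + 'X^r.
Proof.
move=> ir; rewrite big_nat_recr //= raddfD /= root_poly_segment // root_poly_last.
by rewrite mulr2n addrA subrK.
Qed.

Lemma root_poly_double r i : (i <= r)%N ->
  root_poly r.+1 (\sum_(i.+1 <= k < r.+1) simple_root r.+1 k *+ 2
                  + simple_root r.+1 r.+1) = 'X^i *+ 2.
Proof.
by move=> ir; rewrite raddfD /= root_poly_last root_poly_segment2 // mulrnBl subrK.
Qed.

Lemma root_poly_short r i j : (i <= j)%N -> (j <= r)%N ->
  root_poly r.+1 (\sum_(i.+1 <= k < j.+1) simple_root r.+1 k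
    + \sum_(j.+1 <= k < r.+1) simple_root r.+1 k *+ 2 + simple_root r.+1 r.+1)
  = 'X^i + 'X^j.
Proof.
move=> ij jr; rewrite -addrA raddfD /= root_poly_double // root_poly_segment //.
by rewrite mulr2n addrA subrK.
Qed.

Lemma mem_map_root_poly r :
  [seq root_poly r.+1 v | v <- pos_roots r.+1] =i rootsD r.+1 ++ rootsA r.+1.
Proof.
move=> p; rewrite mem_cat; apply/mapP/orP => [[v /pos_rootsP[]]|].
- case=> i [j [ij + ->]] ->; rewrite ltnS leq_eqVlt => /orP[/eqP je|jr].
    (* A segment that reaches the long simple root becomes a sum of two basis vectors; any other
       becomes a difference. *)
    rewrite je in ij *; rewrite root_poly_segment_last //.
    by left; apply/rootsDP; exists i, r.
  by right; apply/rootsAP; exists i, j.+1; rewrite root_poly_segment // ltnW.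
- case=> i [j [ij jr ->]] ->; rewrite !ltnS in jr.
  rewrite root_poly_short ?(ltnW ij) ?(ltnW jr) //.
  by left; apply/rootsDP; exists i, j; split; rewrite // ltnW.
- case=> i ir -> ->; rewrite root_poly_double; last exact: ltnW.
  by left; apply/rootsDP; exists i, i; split; rewrite // ltnW.
case=> [/rootsDP[i [j [ij jr ->]]]|/rootsAP[i [[|j] [//= ij jr ->]]]]; last first.
  exists (\sum_(i.+1 <= k < j.+2) simple_root r.+1 k).
    by apply/pos_rootsP; constructor 1; exists i, j; split; rewrite // ltnW.
  by rewrite root_poly_segment // ltnW.
move: jr; rewrite ltnS leq_eqVlt => /orP[/eqP je|jr].
  rewrite je in ij *; exists (\sum_(i.+1 <= k < r.+2) simple_root r.+1 k).
    by apply/pos_rootsP; constructor 1; exists i, r.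
  by rewrite root_poly_segment_last.
move: ij; rewrite leq_eqVlt => /orP[/eqP ->|ij]; last first.
  exists (\sum_(i.+1 <= k < j.+1) simple_root r.+1 k
   + \sum_(j.+1 <= k < r.+1) simple_root r.+1 k *+ 2 + simple_root r.+1 r.+1).
    by apply/pos_rootsP; constructor 2; exists i, j.
  by rewrite root_poly_short // ltnW.
exists (\sum_(j.+1 <= k < r.+1) simple_root r.+1 k *+ 2 + simple_root r.+1 r.+1).
  by apply/pos_rootsP; constructor 3; exists j.
by rewrite root_poly_double ?mulr2n // ltnW.
Qed.

Lemma card_partitionsE r k :
  #|partitions r.+1 k| = npart (rootsD r.+1 ++ rootsA r.+1) ('X^0 *+ 2) k.
Proof.
pose g (b : seq_sub (pos_roots r.+1)) := root_poly r.+1 (val b).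
have -> : npart (rootsD r.+1 ++ rootsA r.+1) ('X^0 *+ 2) k
        = npart [seq g b | b <- enum {: seq_sub (pos_roots r.+1)}] ('X^0 *+ 2) k.
  apply: npart_perm; apply: uniq_perm; first exact: rootsC_uniq.
    by rewrite map_inj_uniq ?enum_uniq // => x y /root_poly_inj/val_inj.
  move=> p; rewrite -mem_map_root_poly; apply/mapP/mapP => -[v].
    by move=> vr ->; exists (SeqSub vr); rewrite ?mem_enum.
  by move=> _ ->; exists (val v) => //; apply: valP.
rewrite -(@card_npart _ _ g _ k k) //; apply: eq_card => m; rewrite !inE; congr (_ && _).
rewrite -(inj_eq (@root_poly_inj r.+1)) root_poly_double // raddf_sum.
by congr (_ == _); apply: eq_bigr => b _; rewrite raddfMn.
Qed.

(** * The recurrence *)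

(** What is left of the highest root once the part ['X^i + 'X^j] is removed. *)
Definition wt (i j : nat) : {poly int} := 'X^0 *+ 2 - 'X^i - 'X^j.

(* The coefficients of the F i j of the header, with indices starting at 0. *)
Definition flow (i j k : nat) : nat := npart (rootsA (maxn i j).+1) (wt i j) k.

Lemma coef_wt i j n : (0 < n)%N -> (wt i j)`_n = - (n == i)%:R - (n == j)%:R.
Proof. by move=> n0; rewrite !coefB coefMn !coefXn gtn_eqF // mul0rn sub0r. Qed.

Lemma flowC i j k : flow i j k = flow j i k.
Proof. by rewrite /flow maxnC /wt addrAC. Qed.

(** Independence of the rank: [wt i j] has coefficient 0 in each degree above [i] and [j], so no
    part ends there. *)
Lemma npart_rootsA n i j k : (i < n)%N -> (j < n)%N ->
  npart (rootsA n) (wt i j) k = flow i j k.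
Proof.
have step m : (i < m)%N -> (j < m)%N ->
    npart (rootsA m.+1) (wt i j) k = npart (rootsA m) (wt i j) k.
  move=> im jm; apply: (@npart_peel0 _ (coefp m) (-1)) => //.
  - exact: coef_rootsA_last.
  - exact: coef_rootsA_eq0.
  by rewrite /= coef_wt ?(leq_ltn_trans _ im) // !gtn_eqF // subr0 oppr0.
move=> lt_in jn; have mn : (maxn i j < n)%N by rewrite gtn_max lt_in.
rewrite /flow -(subnKC mn); elim: (n - _)%N => [|d IH]; first by rewrite addn0.
rewrite addnS step // addSn ltnS.
  by rewrite (leq_trans (leq_maxl _ j)) ?leq_addr.
by rewrite (leq_trans (leq_maxr i _)) ?leq_addr.
Qed.

Lemma flow00 k : flow 0 0 k = (k == 0)%N.
Proof. by rewrite /flow /wt /= mulr2n addrK subrr eqxx. Qed.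

Lemma flow_lt0 i n : (i < n)%N -> flow i n 0 = 0%N.
Proof.
move=> lt_in; rewrite /flow npart0; case: eqP => // /(congr1 (coefp n)).
by rewrite /= coef_wt ?(leq_ltn_trans _ lt_in) //= coef0 eqxx (gtn_eqF lt_in).
Qed.

(** The coefficient -1 in degree [n] forces exactly one part ['X^j - 'X^n], and removing it turns
    [wt i n] into [wt i j]. *)
Lemma flow_ltS i n k : (i < n)%N -> flow i n k.+1 = (\sum_(j < n) flow i j k)%N.
Proof.
move=> lt_in; rewrite /flow (maxn_idPr (ltnW lt_in)).
rewrite [LHS](@npart_peel1 _ (coefp n) (-1)) //; first last.
- by rewrite /= coef_wt ?(leq_ltn_trans _ lt_in) // eqxx (gtn_eqF lt_in) sub0r.
- exact: coef_rootsA_eq0.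
- exact: coef_rootsA_last.
rewrite big_map (perm_big _ (permEl (perm_rev _))) -{1}(subn0 n) -/(index_iota 0 n) big_mkord.
apply: eq_bigr => j _; rewrite -/(flow i j k) -(npart_rootsA n) //.
by congr npart; rewrite /wt; ring.
Qed.

Lemma flow_diag_lt2 n k : (0 < n)%N -> (k < 2)%N -> flow n n k = 0%N.
Proof.
move=> n0 k2; rewrite /flow maxnn; apply: (@npart_peel_lt _ (coefp n) (-1) _ _ _ _ _ 2) => //.
- exact: coef_rootsA_last.
- exact: coef_rootsA_eq0.
by rewrite /= coef_wt // eqxx.
Qed.

(** Here the coefficient in degree [n] is -2, so exactly two parts end at [n]. *)
Lemma flow_diagSS n k : (0 < n)%N ->
  flow n n k.+2 = (\sum_(j < n) \sum_(i < j.+1) flow i j k)%N.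
Proof.
move=> n0; rewrite {1}/flow maxnn.
rewrite [LHS](@npart_peel2 _ (coefp n) (-1)) //.
- apply: eq_bigr => j _; apply: eq_bigr => i _.
  rewrite -(npart_rootsA n) ?(leq_trans (ltn_ord i)) //.
  by congr npart; rewrite /wt; ring.
- move=> i lt_in; apply: coef_rootsA_last; apply/mapP; exists i => //.
  by rewrite mem_rev mem_iota.
- exact: coef_rootsA_eq0.
by rewrite /= coef_wt // eqxx.
Qed.

(** The highest root takes the value 2 at 1, so exactly one part lies in [rootsD]. *)
Lemma card_partitionsS r k :
  #|partitions r.+1 k.+1| = (\sum_(j < r.+1) \sum_(i < j.+1) flow i j k)%N.
Proof.
rewrite card_partitionsE (@npart_peel1 _ (horner_eval 1) 2) //.
- rewrite big_allpairs_dep -/(index_iota 0 r.+1) big_mkord.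
  apply: eq_bigr => j _; rewrite -/(index_iota 0 j.+1) big_mkord.
  apply: eq_bigr => i _; rewrite -(npart_rootsA r.+1) ?(leq_trans (ltn_ord i)) //.
  by rewrite /wt opprD addrA.
- exact: horner1_rootsD.
- exact: horner1_rootsA.
by rewrite mulr2n raddfD /= /horner_eval hornerXn expr1n.
Qed.

(** * Generating functions and their recurrence *)

Definition flow_poly (i j : nat) : {poly int} :=
  \poly_(k < (maxn i j).+1.*2) (flow i j k)%:R.

Lemma coef_flow_poly i j k : (flow_poly i j)`_k = (flow i j k)%:R.
Proof.
rewrite coef_poly; case: ltnP => // hk; apply/eqP; rewrite eq_sym pnatr_eq0.
wlog ij : i j hk / (i <= j)%N.
  move=> H; case: (leqP i j) => [|/ltnW] ij; first exact: H.
  by rewrite flowC H // maxnC.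
rewrite (maxn_idPr ij) in hk.
(* The truncation loses nothing: [flow i j k] is a summand of the number of partitions with [k.+1]
   parts in rank [j.+1], which is 0 by the height bound. *)
have := @card_partitions_eq0 j.+1 k.+1 isT (leqW hk).
rewrite card_partitionsS big_ord_recr /= => /eqP; rewrite addn_eq0 => /andP[_].
by rewrite sum_nat_eq0 => /forallP/(_ (Ordinal (ij : i < j.+1)%N)).
Qed.

Lemma flow_polyC i j : flow_poly i j = flow_poly j i.
Proof. by apply/polyP => k; rewrite !coef_flow_poly flowC. Qed.

Lemma flow_poly00 : flow_poly 0 0 = 1.
Proof. by apply/polyP => k; rewrite coef_flow_poly flow00 coef1. Qed.

Lemma flow_poly_lt i n : (i < n)%N ->
  flow_poly i n = 'X * \sum_(j < n) flow_poly i j.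
Proof.
move=> lt_in; apply/polyP => -[|k]; rewrite coefXM coef_flow_poly /=.
  by rewrite flow_lt0.
rewrite flow_ltS // coef_sum natr_sum.
by apply: eq_bigr => j _; rewrite coef_flow_poly.
Qed.

Definition flow_sum (n : nat) : {poly int} :=
  \sum_(j < n) \sum_(i < j.+1) flow_poly i j.

Lemma coef_flow_sum n k :
  (flow_sum n)`_k = (\sum_(j < n) \sum_(i < j.+1) flow i j k)%N%:R.
Proof.
rewrite /flow_sum coef_sum natr_sum; apply: eq_bigr => j _.
by rewrite coef_sum natr_sum; apply: eq_bigr => i _; rewrite coef_flow_poly.
Qed.

Lemma kostantCE n : (0 < n)%N -> kostantC n = 'X * flow_sum n.
Proof.
case: n => // n _; apply/polyP => -[|k]; rewrite coef_kostantC // coefXM /=.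
  by rewrite card_partitions_eq0.
by rewrite coef_flow_sum card_partitionsS.
Qed.

Lemma flow_poly_diag n : (0 < n)%N -> flow_poly n n = 'X * kostantC n.
Proof.
move=> n0; rewrite kostantCE // mulrA -expr2; apply/polyP => k.
rewrite coefXnM coef_flow_poly; case: ltnP => k2; first by rewrite flow_diag_lt2.
by rewrite -{1}(subnK k2) addn2 flow_diagSS // coef_flow_sum.
Qed.

(** By symmetry, the two triangles of the square agree and share the diagonal. *)
Lemma sum_flow_poly_square n :
  \sum_(i < n) \sum_(j < n) flow_poly i j
  = flow_sum n *+ 2 - \sum_(i < n) flow_poly i i.
Proof.
elim: n => [|n IH]; first by rewrite /flow_sum !big_ord0 mul0rn subr0.
rewrite /flow_sum 3!big_ord_recr /= -/(flow_sum n).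
under eq_bigr do rewrite big_ord_recr /=.
rewrite big_split /= IH [in RHS]big_ord_recr /= (big_ord_recr n) /=.
under [in X in _ + X]eq_bigr do rewrite flow_polyC.
by ring.
Qed.

(** The added column [j = n] splits into its entries with [i < n], which sum to ['X] times the
    square, and its diagonal entry. *)
Lemma flow_sumS n : (0 < n)%N ->
  flow_sum n.+1 = flow_sum n
    + 'X * (flow_sum n *+ 2 - 1 - 'X * \sum_(1 <= i < n) kostantC i)
    + 'X * kostantC n.
Proof.
move=> n0; rewrite {1}/flow_sum big_ord_recr /= -/(flow_sum n) -addrA; congr (_ + _).
rewrite big_ord_recr /= flow_poly_diag //; congr (_ + _).
rewrite (eq_bigr (fun i : 'I_n => 'X * \sum_(j < n) flow_poly i j)); last first.
  by move=> i _; apply: flow_poly_lt.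
rewrite -mulr_sumr sum_flow_poly_square; congr (_ * _).
(* The diagonal entry at 0 is the empty partition and gives the term 1; the others are
   ['X * kostantC i]. *)
rewrite -(big_mkord xpredT (fun i => flow_poly i i)) big_ltn // flow_poly00.
rewrite opprD addrA mulr_sumr; congr (_ - _).
by apply: eq_big_nat => i /andP[i0 _]; apply: flow_poly_diag.
Qed.

Theorem theorem4p2 (r : nat) (hr : (3 <= r)%N) :
  kostantC r =
    (1 + 'X) ^+ 2 * (kostantC (r - 1)%N - 'X)
    - 'X^3 * (\sum_(1 <= i < (r - 1)%N) kostantC i)
    + ('X + 'X^2 + 'X^3).
Proof.
case: r hr => // n hn; have n0 : (0 < n)%N by case: n hn.
(* Multiplying [flow_sumS] by q gives (1+q)^2 P_n - q^2 - q^3 (P_1 + ... + P_(n-1)), and -q^2 =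
   -q(1+q)^2 + q + q^2 + q^3. *)
rewrite subn1 /= kostantCE // flow_sumS // kostantCE //.
by ring.
Qed.
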